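(* Let $\mathcal{A}^{[m,n]}=\bigoplus_{\mathsf{g}\in\mathsf{G}^{[n']}}\mathcal{A}(\mathsf{g})$ be a nonzero polyadic $\Bbbk$-algebra that is strongly graded by a finite commutative $n'$-ary group $\mathsf{G}^{[n']}$ with underlying set $G$. Then the order $|G|$ of the grading group and the arity $m$ of the algebra addition are connected by $$|G|=\ell_m(m-1)+1,$$ where $\ell_m\in\mathbb{N}_0$ is the polyadic power of the $m$-ary addition (the number of $m$-ary additions) in the decomposition of elements of $\mathcal{A}^{[m,n]}$ into homogeneous elements, one from each contributing component.
   Context: **Polyadic operations.** An $n$-ary operation $\mu^{[n]}:A^{\times n}\to A$ is totally associative if the result of composing it with itself does not depend on the position of the inner operation. Composing an $n$-ary associative operation with itself $\ell$ times (polyadic power $\ell$; notation $\mu^{[n]\circ\ell}$) gives an operation on words of length exactly $\ell(n-1)+1$; these are the only admissible word lengths. An $n'$-ary group is a set $G$ with a totally associative $n'$-ary operation $\mu_g^{[n']}$ such that every $\mathsf{g}\in G$ has a unique querelement $\bar{\mathsf{g}}$, defined by $\mu_g^{[n']}[\mathsf{g},\ldots,\mathsf{g},\bar{\mathsf{g}}]=\mathsf{g}$ ($n'-1$ copies of $\mathsf{g}$). No identity element is required. Grading groups are assumed commutative. **Polyadic algebra.** $\mathcal{A}^{[m,n]}=\langle A\mid\nu_a^{[m]},\mu_a^{[n]}\rangle$ is an algebra over an ordinary (binary) field $\Bbbk$ with a totally associative $m$-ary addition $\nu_a^{[m]}$ and a totally associative $n$-ary multiplication $\mu_a^{[n]}$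 that is distributive over the addition and compatible with scalars. Standing assumption: $\mu_a^{[n]}$ and $\mu_g^{[n']}$ are nonderived, i.e. they are not compositions of binary operations only. **Grading.** $\mathcal{A}^{[m,n]}$ is $\mathsf{G}$-graded if it is a direct sum of $\Bbbk$-vector spaces $\mathcal{A}(\mathsf{g})$, $\mathsf{g}\in\mathsf{G}^{[n']}$ (distinct components have no nonzero element in common), with $$\mu_a^{[n]}[\mathcal{A}(\mathsf{g}_1),\ldots,\mathcal{A}(\mathsf{g}_n)]\subseteq\mathcal{A}(\mu_g^{[n']}[\mathsf{g}_1,\ldots,\mathsf{g}_{n'}]).$$ It is strongly graded if equality always holds here. The support $\mathrm{supp}(\mathcal{A}^{[m,n]})$ is the set of $\mathsf{g}$ whose component $\mathcal{A}(\mathsf{g})$ contributes (is nonzero) to the direct sum. **Decomposition of elements.** The direct sum decomposition means that each element is a finite sum, formed with the $m$-ary addition, of homogeneous elements: $$\mathbf{a}=\nu_a^{[m]\circ\ell_m}[\mathbf{a}(\mathsf{g}_1),\mathbf{a}(\mathsf{g}_2),\ldots,\mathbf{a}(\mathsf{g}_{\ell_m(m-1)+1})],\qquad \mathbf{a}(\mathsf{g}_i)\in\mathcal{A}(\mathsf{g}_i),$$ where $\mathsf{g}_1,\ldots,\mathsf{g}_{\ell_m(m-1)+1}$ lists each element of the support exactly once, so the number of summands equals $|\mathrm{supp}(\mathcal{A}^{[m,n]})|$, and $\ell_m$ is the number of $m$-ary additions used. *)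

(* Defs.v *)
From mathcomp Require Import all_boot all_fingroup all_algebra.

Set Implicit Arguments.
Unset Strict Implicit.
Unset Printing Implicit Defensive.

Import GRing.Theory.
Local Open Scope ring_scope.

Section PolyadicOperations.

Variables (T : Type) (n : nat) (mu : n.-tuple T -> T).

(* Whenever two insertions of an inner operation into an outer one read the    *)
(* same word of 2n - 1 letters, they have the same value.                      *)
Definition totally_associative : Prop :=
  forall (u w u' w' : seq T) (v v' t t' : n.-tuple T),
    tval t = u ++ mu v :: w -> tval t' = u' ++ mu v' :: w' ->
    u ++ v ++ w = u' ++ v' ++ w' -> mu t = mu t'.

Definition polyadic_commutative : Prop :=
  forall (t : n.-tuple T) (s : 'S_n), mu [tuple tnth t (s i) | i < n] = mu t.

Definition querelement (g q : T) : Prop :=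
  mu [tuple if i.+1 == n then q else g | i < n] = g.

Definition polyadic_group : Prop :=
  totally_associative /\ (forall g, exists! q, querelement g q).

(* polyadic_power l s a : the word s is reduced to the letter a by exactly l   *)
(* applications of mu, i.e. a is the value of the l-th polyadic power on s.    *)
(* Words of inadmissible length have no value; when mu is totally associative  *)
(* the value does not depend on the order of the reductions.                   *)
Inductive polyadic_power : nat -> seq T -> T -> Prop :=
| PolyadicPower0 a : polyadic_power 0 [:: a] a
| PolyadicPowerS l u (v : n.-tuple T) w a :
    polyadic_power l (u ++ mu v :: w) a -> polyadic_power l.+1 (u ++ v ++ w) a.

Definition tuple_set (t : n.-tuple T) (i : 'I_n) (x : T) : n.-tuple T :=
  [tuple if j == i then x else tnth t j | j < n].

End PolyadicOperations.

Definition derived (T : Type) (n : nat) (mu : n.-tuple T -> T) : Prop :=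
  exists2 op : 2.-tuple T -> T, totally_associative op &
    forall t : n.-tuple T, polyadic_power op n.-1 t (mu t).

Definition nonderived (T : Type) (n : nat) (mu : n.-tuple T -> T) : Prop :=
  ~ derived mu.

(* The m-ary addition is the only addition of the algebra. The sum of two      *)
(* vectors need not make sense, so the distributivity of scalars over vectors  *)
(* is stated for m-fold sums of scalars. For m = 2 the first six axioms are    *)
(* those of an ordinary vector space over k.                                   *)
Record polyadicAlgebra (k : fieldType) (m n : nat) := PolyadicAlgebra {
  pcarrier :> Type;
  padd : m.-tuple pcarrier -> pcarrier;
  pmul : n.-tuple pcarrier -> pcarrier;
  pscale : k -> pcarrier -> pcarrier;
  padd_group : polyadic_group padd;
  padd_comm : polyadic_commutative padd;
  pscaleA : forall (c d : k) a, pscale c (pscale d a) = pscale (c * d) a;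
  pscale1 : forall a, pscale 1 a = a;
  pscaleDr : forall c (a : m.-tuple pcarrier),
    pscale c (padd a) = padd [tuple pscale c (tnth a j) | j < m];
  pscaleDl : forall (c : 'I_m -> k) a,
    pscale (\sum_(j < m) c j) a = padd [tuple pscale (c j) a | j < m];
  pmulA : totally_associative pmul;
  pmulD : forall (t : n.-tuple pcarrier) (i : 'I_n) (b : m.-tuple pcarrier),
    pmul (tuple_set t i (padd b)) =
    padd [tuple pmul (tuple_set t i (tnth b j)) | j < m];
  pmulZ : forall (t : n.-tuple pcarrier) (i : 'I_n) c x,
    pmul (tuple_set t i (pscale c x)) = pscale c (pmul (tuple_set t i x))
}.

Arguments padd {k m n} _ _.
Arguments pmul {k m n} _ _.
Arguments pscale {k m n _} _ _.

Section GradedPolyadicAlgebras.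

Variables (k : fieldType) (m n : nat) (A : polyadicAlgebra k m n).

(* For m > 2 an m-ary addition may have no neutral element, or several; zero   *)
(* elements are therefore the elements 0 *: b (equivalently, those fixed by    *)
(* 0). If the addition has a neutral vector 0 with 0 *: b = 0, that is the     *)
(* only one.                                                                   *)
Definition is_zero (a : A) : Prop := pscale 0 a = a.

Definition nonzero_subset (V : A -> Prop) : Prop := exists2 a, V a & ~ is_zero a.

Definition nonzero_algebra : Prop := nonzero_subset (fun _ => True).

Record subspace (V : A -> Prop) : Prop := Subspace {
  subspace_nonempty : exists a, V a;
  subspace_add : forall t : m.-tuple A, (forall i, V (tnth t i)) -> V (padd A t);
  subspace_scale : forall c a, V a -> V (pscale c a)
}.

Definition linear_span (S : A -> Prop) (a : A) : Prop :=
  forall V, subspace V -> (forall x, S x -> V x) -> V a.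

Variables (G : finType) (n' : nat) (mug : n'.-tuple G -> G).
Variable comp : G -> A -> Prop.

Definition supp (g : G) : Prop := nonzero_subset (comp g).

(* The direct sum decomposition uses l m-ary additions: every element is a sum *)
(* of homogeneous elements, one for each g in the support, and the components  *)
(* are independent (in an ordinary vector space this is the uniqueness of the  *)
(* homogeneous summands).                                                      *)
Definition decomposition_power (l : nat) : Prop :=
  exists gs : seq G,
    [/\ uniq gs,
        forall g, g \in gs <-> supp g,
        forall a : A, exists2 f : G -> A,
          (forall g, comp g (f g)) & polyadic_power (padd A) l (map f gs) a
      & forall (f : G -> A) (z : A),
          (forall g, comp g (f g)) -> polyadic_power (padd A) l (map f gs) z ->
          is_zero z -> forall g, g \in gs -> is_zero (f g)].

(* The set of products mul[a_1, ..., a_n] with a_i in comp g_i.                *)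
Definition component_products (g : nat -> G) (a : A) : Prop :=
  exists2 t : n.-tuple A, (forall i : 'I_n, comp (g i) (tnth t i)) & a = pmul A t.

(* A single sequence g_1, g_2, ... supplies the n components multiplied in the *)
(* algebra and the n' elements multiplied in the grading group.                *)
Record graded : Prop := Graded {
  graded_subspace : forall g, subspace (comp g);
  graded_disjoint : forall g h a, g <> h -> comp g a -> comp h a -> is_zero a;
  graded_sum : exists l, decomposition_power l;
  graded_mul : forall (g : nat -> G) a,
    component_products g a -> comp (mug [tuple g i | i < n']) a
}.

(* As usual for products of subspaces, mul[comp g_1, ..., comp g_n] in the     *)
(* equality is the subspace spanned by the products. Equality with the bare    *)
(* set of products is a special case, since components are subspaces.          *)
Definition strongly_graded : Prop :=
  graded /\
  forall (g : nat -> G) a,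
    linear_span (component_products g) a <-> comp (mug [tuple g i | i < n']) a.

End GradedPolyadicAlgebras.

(* Main.v *)
Require Import Defs.
From mathcomp Require Import all_boot all_fingroup all_algebra.
From mathcomp Require Import zify.
From Stdlib Require Import Classical.

(** The decomposition of an element adds one homogeneous summand for each point
    of the support, and [l] additions of arity [m] consume words of exactly
    [l * (m - 1) + 1] letters ([polyadic_power_size]). So the claim is that the
    support is all of [G].

    In a strongly graded algebra the component at a product [g_1 ... g_n'] is
    spanned by products having a factor in the component at [g_1]. If the latter
    has only zero elements, so has the former: the complement of the support is
    an ideal of [G] ([unsupported_absorbing]). The support is not empty, as a sum
    has at least one summand, so it remains to see that a finite commutative
    polyadic group has no ideals besides the empty one and itself
    ([absorbing_full]).

    For a polyadic group given by unique querelements this last fact needs an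
    argument, since translations are not known to be bijective. Let [z] be in
    the ideal [I], let [x] have querelement [q], and let [f] be an iterate of the
    translation [y |-> z ... z y]; finiteness lets us choose it with
    [f (f x) = f x]. Translations can be moved across products, so with
    [x' = f x] both [q] and [f q] solve [x' ... x' y = x']: the two products
    are [f] applied [n' - 1] times, respectively [n'] times, to [x ... x q = x].
    By uniqueness [q = f q], which lies in [I]; hence [x = x ... x q] does too. *)

Set Implicit Arguments.
Unset Strict Implicit.
Unset Printing Implicit Defensive.

Import GRing.Theory.

(** * Words and translations *)

Section Words.

Variables (T : Type) (n : nat) (mu : n.-tuple T -> T).

Lemma polyadic_power_size (l : nat) (s : seq T) (a : T) :
  0 < n -> polyadic_power mu l s a -> size s = l * (n - 1) + 1.
Proof.
move=> n_gt0; elim=> {l s a} [//|l u v w a _].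
rewrite !size_cat /= size_tuple; lia.
Qed.

End Words.

Section Translations.

Variables (T : Type) (n : nat) (mu : n.-tuple T -> T).

Definition translation (z y : T) : T :=
  mu [tuple if i.+1 == n then y else z | i < n].

(** Maps that can be pulled out of a product from any position, as
    multiplications by a scalar can. *)
Definition centralizing (f : T -> T) : Prop :=
  forall (t : n.-tuple T) (i : 'I_n),
    mu (tuple_set t i (f (tnth t i))) = f (mu t).

Lemma tuple_set_id (t : n.-tuple T) (i : 'I_n) : tuple_set t i (tnth t i) = t.
Proof. by apply: eq_from_tnth => j; rewrite tnth_mktuple; case: eqP => [->|]. Qed.

Lemma centralizing_iter (f : T -> T) (N : nat) :
  centralizing f -> centralizing (iter N f).
Proof.
move=> fC t i; elim: N => [|N IH] /=; first by rewrite tuple_set_id.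
rewrite -IH -(fC _ i); congr mu; apply: eq_from_tnth => j.
by rewrite !tnth_mktuple eqxx; case: eqP.
Qed.

Lemma centralizing_set (f : T -> T) (t : n.-tuple T) (B : {set 'I_n}) :
  centralizing f ->
  mu [tuple if i \in B then f (tnth t i) else tnth t i | i < n] =
  iter #|B| f (mu t).
Proof.
move=> fC; have [c] := ubnP #|B|; elim: c B => // c IH B.
have [->|[i iB]] := set_0Vmem B => [_|].
  rewrite cards0 /=; congr mu; apply: eq_from_tnth => i.
  by rewrite tnth_mktuple inE.
rewrite (cardsD1 i) iB ltnS => /IH /= <-; rewrite -(fC _ i); congr mu.
apply: eq_from_tnth => j; rewrite !tnth_mktuple !inE eqxx /=.
by case: eqP => [->|_] //=; rewrite iB.
Qed.

Lemma translation_centralizing (z : T) :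
  totally_associative mu -> polyadic_commutative mu ->
  centralizing (translation z).
Proof.
move=> muA muC t i; have n_gt0 : 0 < n by apply: leq_ltn_trans (ltn_ord i).
pose i0 := Ordinal n_gt0.
(* By commutativity the position can be taken to be the first one, where both
   sides read the word z, ..., z, t_1, ..., t_n. *)
suff first (s : n.-tuple T) :
    mu (tuple_set s i0 (translation z (tnth s i0))) = translation z (mu s).
  pose p := tperm i i0.
  rewrite -(muC t p) -first -(muC (tuple_set t i _) p).
  congr mu; apply: eq_from_tnth => j; rewrite !tnth_mktuple.
  by rewrite tpermR -[j == i0](inj_eq (@perm_inj _ p)) [p i0]tpermR.
have word (x : T) : [tuple if j.+1 == n then x else z | j < n] =
    rcons (nseq n.-1 z) x :> seq T.
  apply: (@eq_from_nth _ z) => [|j]; rewrite size_tuple.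
    by rewrite size_rcons size_nseq prednK.
  move=> lt_jn; rewrite (nth_mktuple _ _ (Ordinal lt_jn)) nth_rcons size_nseq /=.
  have [jn|jn] := eqVneq j.+1 n; first by rewrite -jn ltnn eqxx.
  by have lt_j : j < n.-1 by [lia]; rewrite nth_nseq lt_j.
have setE (x : T) : tval (tuple_set s i0 x) = x :: behead s.
  apply: (@eq_from_nth _ z) => [|j]; rewrite size_tuple.
    by rewrite /= size_behead size_tuple prednK.
  move=> lt_jn; rewrite (nth_mktuple _ _ (Ordinal lt_jn)) (tnth_nth z) -val_eqE /=.
  by case: j lt_jn => //= j _; rewrite nth_behead.
have sE : tval s = tnth s i0 :: behead s by rewrite -{1}(tuple_set_id s i0) setE.
apply: (muA [::] (behead s) (nseq n.-1 z) [::] _ s).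
- by rewrite setE.
- by rewrite word cats1.
- by rewrite word cats0 cat0s [in RHS]sE -cats1 -catA.
Qed.

End Translations.

(** * Ideals of finite commutative polyadic groups *)

Lemma iter_idempotent_at (T : finType) (f : T -> T) (x : T) :
  exists2 N, 0 < N & iter N f (iter N f x) = iter N f x.
Proof.
have /trajectP[i lt_io fE] := looping_order f x.
set o := fingraph.order f x in lt_io fE.
have period (k : nat) : iter (k * (o - i) + i) f x = iter i f x.
  elim: k => // k IH.
  have -> : k.+1 * (o - i) + i = (o - i) + (k * (o - i) + i) by lia.
  by rewrite iterD IH -iterD subnK // ltnW.
have o_gt0 : 0 < o by apply: leq_ltn_trans lt_io.
have p_gt0 : 0 < o - i by rewrite subn_gt0.
have le_iN : i <= o * (o - i) by rewrite (leq_trans (ltnW lt_io)) ?leq_pmulr.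
(* A multiple of the period o - i that exceeds the preperiod i. *)
exists (o * (o - i)); first by rewrite muln_gt0 o_gt0.
rewrite -iterD.
have -> : o * (o - i) + o * (o - i) = (o * (o - i) - i) + (o * (o - i) + i) by lia.
by rewrite iterD period -iterD subnK.
Qed.

(** The querelement [q] of [x] falls into the ideal, because at [f x], where [f]
    is an iterated translation by [z], both [q] and [f q] serve as querelements.
    For [n = 2] this is the fact that a finite commutative semigroup in which
    [g q = g] has a unique solution [q] for every [g] is a group. *)
Lemma absorbing_full (G : finType) (n : nat) (mu : n.-tuple G -> G)
    (I : G -> Prop) (z : G) :
  1 < n -> polyadic_group mu -> polyadic_commutative mu ->
  (forall (t : n.-tuple G) (i : 'I_n), I (tnth t i) -> I (mu t)) ->
  I z -> forall x, I x.
Proof.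
move=> n_gt1 [muA muQ] muC Iabs Iz x.
have lt_n1 : n.-1 < n by lia.
pose last := Ordinal lt_n1.
have lastE (i : 'I_n) : (i.+1 == n) = (i == last) by rewrite -val_eqE /=; lia.
have [N N_gt0 ff] := iter_idempotent_at (translation mu z) x.
set f := iter N _ in ff.
have fC : centralizing mu f.
  exact/centralizing_iter/translation_centralizing.
have If (y : G) : I (f y).
  rewrite /f -(prednK N_gt0) iterS.
  by apply: (Iabs _ (Ordinal (ltnW n_gt1))); rewrite tnth_mktuple; case: eqP => //=; lia.
have iter_f (c : nat) : 0 < c -> iter c f x = f x.
  by case: c => // c _; elim: c => //= c ->.
have [q [xq _]] := muQ x; have [q' [_ q'U]] := muQ (f x).
(* Here f is applied to the n - 1 factors x, and in q2 also to the factor q. *)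
have q1 : querelement mu (f x) q.
  have := centralizing_set [tuple if i.+1 == n then q else x | i < n] (~: [set last]) fC.
  rewrite [mu _ in RHS]xq cardsC1 card_ord iter_f; last by lia.
  move=> fxE; rewrite /querelement -[RHS]fxE; congr mu; apply: eq_from_tnth => i.
  by rewrite !tnth_mktuple !inE lastE; case: eqP.
have q2 : querelement mu (f x) (f q).
  have := centralizing_set [tuple if i.+1 == n then q else x | i < n] setT fC.
  rewrite [mu _ in RHS]xq cardsT card_ord iter_f; last by lia.
  move=> fxE; rewrite /querelement -[RHS]fxE; congr mu; apply: eq_from_tnth => i.
  by rewrite !tnth_mktuple !inE; case: eqP.
have Iq : I q by rewrite -(q'U _ q1) (q'U _ q2); apply: If.
rewrite -xq; apply: (Iabs _ last).
by rewrite tnth_mktuple lastE eqxx.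
Qed.

(** * Zero elements and the support *)

Section ZeroElements.

Variables (k : fieldType) (m n : nat) (A : polyadicAlgebra k m n).

Lemma is_zero_scale0 (a : A) : is_zero (pscale 0%R a).
Proof. by rewrite /is_zero pscaleA mul0r. Qed.

Lemma subspace_is_zero (a : A) : subspace (@is_zero k m n A).
Proof.
split; first by exists (pscale 0%R a); apply: is_zero_scale0.
- move=> t t0; rewrite /is_zero pscaleDr; congr (padd A).
  by apply: eq_from_tnth => i; rewrite tnth_mktuple t0.
- by move=> c b b0; rewrite /is_zero -[in RHS]b0 !pscaleA mul0r mulr0.
Qed.

Lemma pmul_is_zero (t : n.-tuple A) (i : 'I_n) :
  is_zero (tnth t i) -> is_zero (pmul A t).
Proof.
move=> ti0; rewrite -(tuple_set_id t i) -ti0 pmulZ.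
exact: is_zero_scale0.
Qed.

(** Commutativity lets the unsupported factor be moved to the front, where it
    indexes both a factor of the algebra product and one of the group product,
    whichever of the two arities is larger. *)
Lemma unsupported_absorbing (G : finType) (n' : nat) (mug : n'.-tuple G -> G)
    (comp : G -> A -> Prop) (t : n'.-tuple G) (i : 'I_n') :
  0 < n -> polyadic_commutative mug -> strongly_graded mug comp ->
  ~ supp comp (tnth t i) -> ~ supp comp (mug t).
Proof.
move=> n_gt0 mugC [_ strong] tiN; have n'_gt0 := leq_ltn_trans (leq0n i) (ltn_ord i).
pose t' := [tuple tnth t (tperm i (Ordinal n'_gt0) j) | j < n'].
rewrite -(mugC t (tperm i (Ordinal n'_gt0))) -/t'.
pose g := nth (tnth t i) t'.
have -> : t' = [tuple g j | j < n'].
  by apply: eq_from_tnth => j; rewrite [RHS]tnth_mktuple (tnth_nth (tnth t i)).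
have g0 : g 0 = tnth t i.
  by rewrite /g (nth_mktuple _ _ (Ordinal n'_gt0)) tpermR.
case=> a /strong a_span; apply; apply: a_span; first exact: subspace_is_zero.
move=> _ [s s_comp ->]; apply: (@pmul_is_zero s (Ordinal n_gt0)).
apply: NNPP => s0; apply: tiN; rewrite -g0.
by exists (tnth s (Ordinal n_gt0)); first exact: (s_comp (Ordinal n_gt0)).
Qed.

End ZeroElements.

Theorem theorem3p9 (k : fieldType) (m n n' : nat)
    (A : polyadicAlgebra k m n)
    (G : finType) (mug : n'.-tuple G -> G) (comp : G -> A -> Prop)
    (m_ge2 : 1 < m) (n_ge2 : 1 < n) (n'_ge2 : 1 < n')
    (mug_group : polyadic_group mug) (mug_comm : polyadic_commutative mug)
    (pmul_nonderived : nonderived (pmul A)) (mug_nonderived : nonderived mug)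
    (A_nonzero : nonzero_algebra A)
    (A_strong : strongly_graded mug comp)
    (l : nat) (l_power : decomposition_power comp l) :
  #|G| = l * (m - 1) + 1.
Proof.
have [gs [gs_uniq gsP gs_sum _]] := l_power; have [a _ _] := A_nonzero.
have [f _ /(polyadic_power_size (ltnW m_ge2))] := gs_sum a.
rewrite size_map => gs_size; rewrite -gs_size.
have [g0 g0_gs] : exists g0, g0 \in gs.
  by case: (gs) gs_size => [|g0 r _]; [rewrite addn1 | exists g0; rewrite mem_head].
have full (h : G) : h \in gs.
  apply: contraT => h_gs.
  have hN : ~ supp comp h by move=> /gsP; apply/negP.
  suff all_unsupp (x : G) : ~ supp comp x by case: (all_unsupp g0); apply/gsP.
  apply: (absorbing_full (I := fun g => ~ supp comp g) n'_ge2 mug_group mug_comm _ hN) => t i.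
  by apply: unsupported_absorbing => //; apply: ltnW.
by rewrite -(card_uniqP gs_uniq); apply/esym/eq_card => h; rewrite full inE.
Qed.
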